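(* Let $q\in(0,1)$ be fixed. For every pair of non-negative integers $k$ and $n$, let $$T(k,n):=\frac{1}{(-2)^n[n]_q^{!}}\,q^{-\frac{n(n-1)}{4}}\left.\mathcal{D}_q^n x^k\right|_{x=\hat{1}^{(n)}},\qquad \hat 1^{(n)}=\frac{q^{n/2}+q^{-n/2}}{2}.$$ Then $T(k,0)=1$ for all non-negative integers $k$, $T(k,n)=0$ for all non-negative integers $k$ and $n$ with $k<n$, and $$T(k,n)=q^n\left[\frac{1}{(q;q)_n^2}+\sum_{j=1}^n\frac{(-1)^jq^{\frac{j(j-1)}{2}}(1+q^j)}{(q;q)_{n-j}(q;q)_{n+j}}\left(\frac{q^j+q^{-j}}{2}\right)^k\right]$$ for every pair of positive integers $k$ and $n$. In particular: (i) The numbers $T(k,n)$ satisfy the recurrence $$T(k,n)=\frac{q^n+q^{-n}}{2}T(k-1,n)-\frac{q^{1-n}}{2}T(k-1,n-1)$$ for every pair of positive integers $k$ and $n$. In particular, $(-1)^nT(k,n)\ge0$ for every pair of non-negative integers $k$ and $n$. (ii) There exists $K>0$ such that for every pair of positive integers $k$ and $n$, $$(-1)^nT(k,n)\le\frac{Kq^{\frac{n(n+1)}{2}}}{q^{nk}}.$$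
   Context: $(a;q)_n:=\prod_{k=0}^{n-1}(1-aq^k)$, $[n]_q:=\frac{1-q^n}{1-q}$, and $[n]_q^{!}:=\prod_{k=1}^n[k]_q=\frac{(q;q)_n}{(1-q)^n}$. The Askey-Wilson operator $\mathcal{D}_q$: for $x\in\mathbb{C}$ write $x=\frac{z+z^{-1}}2$ and set $\hat x:=\frac{q^{1/2}z+q^{-1/2}z^{-1}}2$, $\check x:=\frac{q^{-1/2}z+q^{1/2}z^{-1}}2$. Then $(\mathcal{D}_qf)(x):=\frac{f(\hat x)-f(\check x)}{\hat x-\check x}$ for $x\neq\pm1$ (independent of the choice of $z$), and $(\mathcal{D}_qf)(\pm1):=\lim_{x\to\pm1}(\mathcal{D}_qf)(x)=f'\left(\pm\frac{q^{1/2}+q^{-1/2}}2\right)$. It maps polynomials to polynomials; $\mathcal{D}_q^n$ is its $n$-th iterate ($\mathcal{D}_q^0$ the identity), and $\left.\mathcal{D}_q^nx^k\right|_{x=\hat1^{(n)}}$ denotes the value at $\hat 1^{(n)}$ of $\mathcal{D}_q^n$ applied to the monomial $x\mapsto x^k$. *)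

(* Defs.v *)
From mathcomp Require Import all_boot all_order all_algebra.
From mathcomp Require Import complex ring.
From mathcomp Require Import all_classical all_reals all_analysis.

Set Implicit Arguments.
Unset Strict Implicit.
Unset Printing Implicit Defensive.

Import Order.TTheory GRing.Theory Num.Theory.
Import numFieldNormedType.Exports.

Local Open Scope classical_set_scope.
Local Open Scope complex_scope.
Local Open Scope ring_scope.

Section qNumbers.
Context {F : fieldType}.
Implicit Types (a q : F) (n : nat).

Definition qpoch a q n : F := \prod_(k < n) (1 - a * q ^+ k).

Definition qint q n : F := (1 - q ^+ n) / (1 - q).

Definition qfact q n : F := \prod_(1 <= k < n.+1) qint q k.

Lemma qfactE q n : qfact q n = qpoch q q n / (1 - q) ^+ n.
Proof.
rewrite /qfact /qpoch big_add1 big_mkord /qint /= big_split /= prodr_const.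
by rewrite card_ord exprVn; congr (_ / _); apply: eq_bigr => k _; rewrite exprS.
Qed.

End qNumbers.

Section AskeyWilson.
Context {R : realType}.
(* The ascription to numClosedFieldType is what gives access to the topology
   of the complex plane. *)
Let C : numClosedFieldType := R[i].
Implicit Types (q : R) (f : C -> C) (x z : C).

Definition joukowski z : C := (z + z^-1) / 2.

(* One of the two solutions z of x = (z + 1/z) / 2; the other one is 1/z.
   By askey_wilsonE below, this choice does not matter. *)
Definition joukowski_inv x : C := x + sqrtC (x ^+ 2 - 1).

(* As functions of z, where x = joukowski z. *)
Definition aw_hat q z : C :=
  ((q `^ (1 / 2))%:C * z + (q `^ (- (1 / 2)))%:C * z^-1) / 2.

Definition aw_check q z : C :=
  ((q `^ (- (1 / 2)))%:C * z + (q `^ (1 / 2))%:C * z^-1) / 2.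

Definition aw_quotient q f z : C :=
  (f (aw_hat q z) - f (aw_check q z)) / (aw_hat q z - aw_check q z).

Definition askey_wilson q f : C -> C := fun x =>
  if (x == 1) || (x == -1)
  then lim (aw_quotient q f (joukowski_inv y) @[y --> x^'])
  else aw_quotient q f (joukowski_inv x).

Definition hat1 q (n : nat) : C :=
  ((q `^ (n%:R / 2) + q `^ (- (n%:R / 2))) / 2)%:C.

Definition awT q (k n : nat) : C :=
  1 / ((-2) ^+ n * (qfact q n)%:C) *
  (q `^ (- (n%:R * (n%:R - 1) / 4)))%:C *
  iter n (askey_wilson q) (fun x => x ^+ k) (hat1 q n).

Lemma joukowski_inv_mul x :
  joukowski_inv x * (x - sqrtC (x ^+ 2 - 1)) = 1.
Proof. by rewrite mulrC -subr_sqr sqrtCK opprB addrC subrK. Qed.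

Lemma joukowski_inv_neq0 x : joukowski_inv x != 0.
Proof.
apply/eqP => h; have /eqP := joukowski_inv_mul x.
by rewrite h mul0r eq_sym oner_eq0.
Qed.

Lemma joukowski_invK : cancel joukowski_inv joukowski.
Proof.
move=> x; rewrite /joukowski.
have -> : (joukowski_inv x)^-1 = x - sqrtC (x ^+ 2 - 1).
  by apply: (mulfI (joukowski_inv_neq0 x)); rewrite mulfV ?joukowski_inv_neq0 ?joukowski_inv_mul.
by rewrite /joukowski_inv; field; rewrite ?pnatr_eq0.
Qed.

Lemma joukowski_eq z w : z != 0 -> w != 0 ->
  joukowski z = joukowski w -> w = z \/ w = z^-1.
Proof.
move=> z0 w0 h.
have : (w - z) * (w - z^-1) = 0.
  transitivity (2 * w * (joukowski w - joukowski z)).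
    by rewrite /joukowski; field; rewrite z0 w0.
  by rewrite h subrr mulr0.
by move=> /eqP; rewrite mulf_eq0 !subr_eq0 => /orP[] /eqP ->; [left|right].
Qed.

Lemma aw_quotientV q f z : aw_quotient q f z^-1 = aw_quotient q f z.
Proof.
have hV : aw_hat q z^-1 = aw_check q z by rewrite /aw_hat invrK addrC.
have cV : aw_check q z^-1 = aw_hat q z by rewrite /aw_check invrK addrC.
by rewrite /aw_quotient hV cV -opprB -(opprB (aw_hat q z)) invrN mulrNN.
Qed.

Lemma askey_wilsonE q f z : z != 0 -> joukowski z != 1 -> joukowski z != -1 ->
  askey_wilson q f (joukowski z) = aw_quotient q f z.
Proof.
move=> z0 /negPf z1 /negPf z2; rewrite /askey_wilson z1 z2 /=.
have [->//|->] := joukowski_eq z0 (joukowski_inv_neq0 (joukowski z))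
  (esym (joukowski_invK (joukowski z))).
exact: aw_quotientV.
Qed.

End AskeyWilson.

(* Main.v *)
Require Import Defs.
From mathcomp Require Import all_boot all_order all_algebra.
From mathcomp Require Import complex.
From mathcomp Require Import all_classical all_reals all_analysis.
From mathcomp Require Import ring lra zify.

Import Order.TTheory GRing.Theory Num.Theory.
Local Open Scope complex_scope.
Local Open Scope ring_scope.

(** Write p = q^(1/2) and h_j = (p^j + p^-j)/2, so that hat1 q j = h_j.  At the
    point h_j with j > 0 the Askey-Wilson operator D is the difference quotient
    of f over the two neighbouring points h_(j+1) and h_(j-1)
    ([askey_wilson_hat1]).  Hence the n-th iterate at h_n only involves f at
    h_0, h_2, ..., h_2n, and every intermediate evaluation takes place at some
    h_j with j > 0; the branch of D at the points 1 and -1, given by a limit, is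
    never met.  Up to a power of p and a q-factorial, D^n f at h_(n+m) is the
    divided difference of f on the nodes h_m, h_(m+2), ..., h_(m+2n).

    The Leibniz rule for divided differences,
      (x f)[y_0, ..., y_n] = y_n f[y_0, ..., y_n] + f[y_0, ..., y_(n-1)],
    here takes the form [iter_askey_wilson_mulx], proved directly by induction
    on n.  Applied to f = x^k and m = 0 it is the recurrence (i) for T(k,n)
    ([awT_rec]).  Together with T(k,0) = 1, and with T(0,n) = 0 for n > 0
    because D kills constants, the recurrence determines T.

    The rest is about the recurrence alone.  Vanishing for k < n and the sign
    (-1)^n follow by induction on k.  The closed form satisfies the same
    recurrence because its coefficients c(n,j) satisfy
      c(n+1,j) (x_(n+1) - x_j) = q^-(n+1)/2 c(n,j),   x_j = (q^j + q^-j)/2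
    ([aw_coef_rec]), and it has the right initial values because, for k = 0,
    its partial sums telescope to an explicit product that vanishes when the
    sum is complete ([aw_coef_psum]).

    For (ii), divide (-1)^n T(k,n) by q^(n(n+1)/2 - nk) and call the result
    c(k,n).  The recurrence becomes, with q^(k-n) <= 1 in the range n <= k that
    matters,
      c(k+1,n+1) = (1 + q^(2n+2))/2 c(k,n+1) + q^(k-n)/2 c(k,n),
    and 1/(q^2;q^2)_n is a supersolution of it ([sign_aw_closed_le]).  This is
    bounded in n, since 1/(x;x)_n <= exp(x/(1-x)^2) ([inv_qpoch_le]). *)

(** * The lattice of nodes *)

Section Lattice.
Context {F : fieldType}.
Implicit Types p q : F.

Definition lattice p (n : nat) : F := (p ^+ n + p ^- n) / 2.

(** The symmetric q-integer.  Since h_(j+n) - h_(j-n) =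
    symqint p n * (h_(j+1) - h_(j-1)), it is the ratio between the n-th step of
    the iterated operator and the n-th step of a divided difference. *)
Definition symqint p (n : nat) : F := (p ^+ n - p ^- n) / (p - p^-1).

Lemma subr_inv_neq0 p : p != 0 -> p ^+ 2 != 1 -> p - p^-1 != 0.
Proof.
move=> p0; apply: contraNneq => /(congr1 ( *%R p)).
by rewrite mulrBr mulfV // mulr0 expr2 => /subr0_eq ->.
Qed.

Lemma lattice_sub1 p n : (2 : F) != 0 -> p != 0 ->
  lattice p n - 1 = (p ^+ n - 1) ^+ 2 / (2 * p ^+ n).
Proof.
by move=> two0 p0; rewrite /lattice; field; rewrite expf_neq0 // two0.
Qed.

Lemma lattice_add1 p n : (2 : F) != 0 -> p != 0 ->
  lattice p n + 1 = (p ^+ n + 1) ^+ 2 / (2 * p ^+ n).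
Proof.
by move=> two0 p0; rewrite /lattice; field; rewrite expf_neq0 // two0.
Qed.

Lemma lattice_diff p n : p != 0 ->
  lattice p n.+2 - lattice p n = (p ^+ n.+1 - p ^- n.+1) * (p - p^-1) / 2.
Proof.
move=> p0; rewrite /lattice !exprS -mulrBl; congr (_ / _).
have pn0 : p ^+ n != 0 by rewrite expf_neq0.
by field; rewrite pn0 p0.
Qed.

Lemma lattice_diff_neq0 p n : (2 : F) != 0 -> p != 0 ->
  (forall k, p ^+ k.+1 != 1) -> lattice p n.+2 - lattice p n != 0.
Proof.
move=> two0 p0 p1; rewrite lattice_diff // !mulf_neq0 ?invr_eq0 //.
  by apply: subr_inv_neq0; rewrite ?expf_neq0 // -exprM muln2 doubleS.
exact: subr_inv_neq0.
Qed.

(** The coefficient of the lower-order term in the Leibniz rule grows from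
    symqint p (n+1) to symqint p (n+2) when one more difference quotient is
    taken; this identity is the induction step. *)
Lemma lattice_diff_symqint p n m : p != 0 -> p ^+ 2 != 1 ->
  (lattice p (m + n.*2).+4 - lattice p (m + n.*2).+2) +
  symqint p n.+1 * (lattice p (n + m).+2 - lattice p (n + m)) =
  symqint p n.+2 * (lattice p (n + m).+3 - lattice p (n + m).+1).
Proof.
move=> p0 p1; rewrite !lattice_diff // /symqint -addnn !exprS !exprD.
have h := subr_inv_neq0 _ p0 p1.
have pn0 : p ^+ n != 0 by rewrite expf_neq0.
have pm0 : p ^+ m != 0 by rewrite expf_neq0.
have [two0|two0] := eqVneq (2 : F) 0; first by rewrite two0 invr0 !mulr0 addr0.
have h' : p * p - 1 != 0 by rewrite subr_eq0 -expr2.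
by field; rewrite pn0 pm0 p0 two0 h'.
Qed.

Lemma symqintE p n : p != 0 -> p ^+ 2 != 1 ->
  symqint p n.+1 = p ^- n * qint (p ^+ 2) n.+1.
Proof.
move=> p0 p1; rewrite /symqint /qint -exprM mul2n -addnn addSnnS exprD exprSr.
have pn0 : p ^+ n != 0 by rewrite expf_neq0.
have h' : 1 - p * p != 0 by rewrite subr_eq0 eq_sym -expr2.
have h : p * p - 1 != 0 by rewrite -oppr_eq0 opprB.
rewrite !exprSr.
by field; rewrite pn0 p0 h h'.
Qed.
End Lattice.

(** * The Askey-Wilson operator on the lattice *)

Section Nodes.
Context {R : realType} (q : R).
Hypotheses (hq0 : 0 < q) (hq1 : q < 1).

Local Notation p := (q `^ (1 / 2)).
Local Notation P := (p%:C).

Lemma sqrt_q_gt0 : 0 < p. Proof. exact: powR_gt0. Qed.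

Lemma powR_half (n : nat) : q `^ (n%:R / 2) = p ^+ n.
Proof. by rewrite -powR_mulrn ?powR_ge0 // -powRrM mul1r mulrC. Qed.

Lemma sqrt_qK : p ^+ 2 = q.
Proof. by rewrite -powR_half divff ?pnatr_eq0 // powRr1 // ltW. Qed.

Lemma sqrt_q_lt1 : p < 1.
Proof. by rewrite -(@expr_lt1 _ 2) ?powR_ge0 // sqrt_qK. Qed.

Lemma sqrt_qC_neq0 : P != 0.
Proof. by rewrite fmorph_eq0 gt_eqF ?sqrt_q_gt0. Qed.

Lemma sqrt_qC_exp_neq1 (n : nat) : P ^+ n.+1 != 1.
Proof.
rewrite -rmorphXn /= fmorph_eq1 lt_eqF // expr_lt1 ?powR_ge0 //.
exact: sqrt_q_lt1.
Qed.

Lemma hat1E (n : nat) : hat1 q n = lattice P n.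
Proof.
rewrite /hat1 /lattice powRN powR_half -rmorphXn.
by rewrite rmorphM rmorphD /= !fmorphV /= rmorph_nat.
Qed.

(** By the square forms of h_j - 1 and h_j + 1, the points where the
    operator is defined by a limit could only be hit if p^j were 1 or -1. *)
Lemma hat1_neq (n : nat) : hat1 q n.+1 != 1 /\ hat1 q n.+1 != -1.
Proof.
have two0 : (2 : R[i]) != 0 by rewrite pnatr_eq0.
rewrite hat1E -subr_eq0 -(subr_eq0 _ (-1)) opprK.
rewrite lattice_sub1 ?lattice_add1 ?sqrt_qC_neq0 //.
have d0 : (2 * P ^+ n.+1)^-1 != 0.
  by rewrite invr_eq0 mulf_neq0 // expf_neq0 // sqrt_qC_neq0.
have a0 : P ^+ n.+1 + 1 != 0.
  have -> : P ^+ n.+1 + 1 = (p ^+ n.+1 + 1)%:C.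
    by rewrite rmorphD rmorphXn rmorph1.
  by rewrite fmorph_eq0 gt_eqF // ltr_pwDl ?ler01 // exprn_gt0 // sqrt_q_gt0.
have s0 : P ^+ n.+1 - 1 != 0 by rewrite subr_eq0 sqrt_qC_exp_neq1.
by rewrite !(mulf_neq0, expf_neq0).
Qed.

(** With z = p^j, multiplying z by q^(1/2) or its inverse shifts j by one. *)
Lemma askey_wilson_hat1 (f : R[i] -> R[i]) (n : nat) :
  askey_wilson q f (hat1 q n.+1) =
  (f (hat1 q n.+2) - f (hat1 q n)) / (hat1 q n.+2 - hat1 q n).
Proof.
have P0 := sqrt_qC_neq0.
have Pn0 : P ^+ n != 0 by rewrite expf_neq0.
have [h1 h2] := hat1_neq n.
have hJ k : hat1 q k = joukowski (P ^+ k) by exact: hat1E.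
rewrite [in LHS]hJ askey_wilsonE -?hJ ?expf_neq0 //.
rewrite /aw_quotient.
have -> : aw_hat q (P ^+ n.+1) = hat1 q n.+2.
  rewrite hJ /aw_hat /joukowski powRN fmorphV /= !exprS.
  move: P0 Pn0; move: (p%:C) => u P0 Pn0.
  by congr (_ / _); field; rewrite Pn0 P0.
have -> : aw_check q (P ^+ n.+1) = hat1 q n.
  rewrite hJ /aw_check /joukowski powRN fmorphV /= !exprS.
  move: P0 Pn0; move: (p%:C) => u P0 Pn0.
  by congr (_ / _); field; rewrite Pn0 P0.
by [].
Qed.

(** The Leibniz rule of divided differences, x being evaluated at the last
    node h_(m+2n+2).  It has to be proved for all m at once: one more
    difference quotient at h_(n+m+2) uses the starting nodes m and m+2. *)
Lemma iter_askey_wilson_mulx (f : R[i] -> R[i]) (n m : nat) :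
  iter n.+1 (askey_wilson q) (fun x => x * f x) (hat1 q (n + m).+1) =
  hat1 q (m + n.*2).+2 * iter n.+1 (askey_wilson q) f (hat1 q (n + m).+1) +
  symqint P n.+1 * iter n (askey_wilson q) f (hat1 q (n + m)).
Proof.
have d0 k : hat1 q k.+2 - hat1 q k != 0.
  rewrite !hat1E; apply: lattice_diff_neq0; rewrite ?pnatr_eq0 //.
    exact: sqrt_qC_neq0.
  exact: sqrt_qC_exp_neq1.
elim: n m => [|n IH] m.
  rewrite !iterS /= !askey_wilson_hat1 double0 addn0 add0n.
  rewrite /symqint !expr1 divff; last first.
    apply: subr_inv_neq0; first exact: sqrt_qC_neq0.
    exact: sqrt_qC_exp_neq1.
  move: (d0 m); move: (hat1 q m.+2) (hat1 q m) => u v uv.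
  by field.
have e : (n.+1 + m = (n + m).+1)%N by [].
have E2 : ((n + m).+3 = (n + m.+2).+1)%N by lia.
rewrite iterS askey_wilson_hat1 e E2 !IH -E2.
rewrite [iter n.+2 _ _]iterS [askey_wilson _ _ (hat1 q (n + m).+2)]askey_wilson_hat1.
have -> : (m + n.+1.*2 = (m + n.*2).+2)%N by lia.
have -> : (m.+2 + n.*2 = (m + n.*2).+2)%N by lia.
have e3 : (n + m.+2 = (n + m).+2)%N by lia.
rewrite e3.
set a2 := iter n.+1 _ _ (hat1 q (n + m).+3).
set a0 := iter n.+1 _ _ (hat1 q (n + m).+1).
set b2 := iter n _ _ (hat1 q (n + m).+2).
set b0 := iter n _ _ (hat1 q (n + m)).
(* The lower-order values recombine into a0, which is their own quotient. *)
have ha : b2 = b0 + a0 * (hat1 q (n + m).+2 - hat1 q (n + m)).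
  by rewrite /a0 iterS askey_wilson_hat1 divfK // addrC subrK.
have := lattice_diff_symqint _ n m sqrt_qC_neq0 (sqrt_qC_exp_neq1 1).
rewrite -!hat1E => hs.
apply: (mulIf (d0 (n + m).+1)).
rewrite divfK // [RHS]mulrDl -(mulrA _ ((a2 - a0) / _)) divfK //.
rewrite [symqint P n.+2 * _ * _]mulrAC -hs ha.
move: a2 a0 b0 {ha hs} (symqint _ _) (hat1 q _) (hat1 q _) (hat1 q _) (hat1 q _).
by move=> *; ring.
Qed.

Lemma awT0 k : awT q k 0 = 1.
Proof.
rewrite /awT /= expr0 /qfact big_geq // mul0r mul0r oppr0 powRr0.
rewrite rmorph1 !mulr1 divr1 mul1r.
rewrite hat1E /lattice expr0 invr1 -mulr2n -[_ *+ 2]/2%:R divff ?pnatr_eq0 //.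
exact: expr1n.
Qed.

Lemma iter_askey_wilson_cst (c : R[i]) (n m : nat) :
  iter n.+1 (askey_wilson q) (fun=> c) (hat1 q (n + m).+1) = 0.
Proof.
elim: n m => [|n IH] m; rewrite iterS askey_wilson_hat1 ?subrr ?mul0r //.
have -> : ((n.+1 + m).+2 = (n + m.+2).+1)%N by lia.
by rewrite addSn !IH subrr mul0r.
Qed.

Lemma awT0n n : awT q 0 n.+1 = 0.
Proof.
rewrite /awT; have := iter_askey_wilson_cst 1 n 0.
by rewrite addn0 => ->; rewrite mulr0.
Qed.

Lemma qint_neq0 (n : nat) : qint q n.+1 != 0.
Proof.
rewrite /qint mulf_neq0 ?invr_eq0 ?subr_eq0 ?gt_eqF //.
by rewrite expr_lt1 // ltW.
Qed.

Lemma qfact_neq0 (n : nat) : qfact q n != 0.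
Proof.
rewrite /qfact big_add1 /= big_mkord; apply/prodf_neq0 => i _.
exact: qint_neq0.
Qed.

(** The Leibniz rule for x^(k+1) = x * x^k at the starting node h_0: the last
    node h_(2n+2) is (q^(n+1) + q^-(n+1))/2, and the ratio of the two
    normalisations turns symqint p (n+1) into - q^-n / 2. *)
Lemma awT_rec (k n : nat) :
  awT q k.+1 n.+1 = ((q ^+ n.+1 + q ^- n.+1) / 2)%:C * awT q k n.+1
                    - (q ^- n / 2)%:C * awT q k n.
Proof.
have hx : (fun x : R[i] => x ^+ k.+1) = (fun x => x * x ^+ k).
  by apply/funext => x; rewrite exprS.
rewrite /awT hx.
have := iter_askey_wilson_mulx (fun x => x ^+ k) n 0.
rewrite addn0 add0n => ->.
have hh : hat1 q (n.*2).+2 = ((q ^+ n.+1 + q ^- n.+1) / 2)%:C.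
  rewrite /hat1 powRN powR_half -[in RHS]sqrt_qK -!exprM.
  by have -> : (n.*2.+2 = 2 * n.+1)%N by lia.
rewrite hh.
rewrite symqintE; [|exact: sqrt_qC_neq0|exact: sqrt_qC_exp_neq1 1%N].
have -> : P ^+ 2 = q%:C by rewrite -rmorphXn /= sqrt_qK.
set A := iter n.+1 _ _ _.
set B := iter n _ _ _.
have -> : qfact q n.+1 = qfact q n * qint q n.+1 by rewrite /qfact big_nat_recr.
have -> : q `^ (- (n.+1%:R * (n.+1%:R - 1) / 4)) =
   q `^ (- (n%:R * (n%:R - 1) / 4)) * p ^- n.
  rewrite -powR_half -powRN -powRD; last by rewrite (gt_eqF hq0) implybT.
  by congr (_ `^ _); rewrite -natr1; field.
have -> : qint (q%:C) n.+1 = (qint q n.+1)%:C.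
  by rewrite /qint rmorphM fmorphV /= !rmorphB !rmorphXn /= rmorph1.
have -> : q ^- n = p ^- n * p ^- n by rewrite -{1}sqrt_qK -exprM mul2n -addnn exprD invfM.
have c0 : (qint q n.+1)%:C != 0 by rewrite fmorph_eq0 qint_neq0.
have d0 : (qfact q n)%:C != 0 by rewrite fmorph_eq0 qfact_neq0.
have Pn0 : P ^+ n != 0 by rewrite expf_neq0 // sqrt_qC_neq0.
have t0 : (-2 : R[i]) ^+ n != 0 by rewrite expf_neq0 // oppr_eq0 pnatr_eq0.
move: ((q ^+ n.+1 + q ^- n.+1) / 2) (q `^ _) (qint _ _) c0 => x w qi c0.
rewrite !rmorphM !fmorphV /= !rmorphXn /= rmorph_nat exprS.
move: (P ^+ n) Pn0 qi%:C c0 (qfact q n)%:C d0 ((-2) ^+ n) t0 x%:C w%:C A B.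
move=> u u0 qi' c0 qf' d0 t t0 x' w' A B.
by field; rewrite t0 d0 c0 u0.
Qed.
End Nodes.

(** * The closed form *)

Section ClosedForm.
Context {F : fieldType} (q : F).
Hypotheses (q0 : q != 0) (q1 : forall k, q ^+ k.+1 != 1) (two0 : (2 : F) != 0).

Definition aw_coef (n j : nat) : F :=
  (-1) ^+ j * q ^+ 'C(j, 2) * (1 + q ^+ j) /
  (qpoch q q (n - j) * qpoch q q (n + j)).

Definition aw_closed (k n : nat) : F :=
  q ^+ n * (1 / qpoch q q n ^+ 2 +
            \sum_(1 <= j < n.+1) aw_coef n j * lattice q j ^+ k).

Lemma qpochS n : qpoch q q n.+1 = qpoch q q n * (1 - q ^+ n.+1).
Proof. by rewrite /qpoch big_ord_recr /= -exprS. Qed.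

Lemma sub1X_neq0 n : 1 - q ^+ n.+1 != 0.
Proof. by rewrite subr_eq0 eq_sym. Qed.

Lemma qpoch_neq0 n : qpoch q q n != 0.
Proof. by apply/prodf_neq0 => k _; rewrite -exprS sub1X_neq0. Qed.

Lemma lattice_sub m j : (j <= m)%N ->
  lattice q m - lattice q j =
  q ^- m / 2 * ((1 - q ^+ (m - j)) * (1 - q ^+ (m + j))).
Proof.
move=> jm; rewrite /lattice -{1 2 3 5}(subnK jm).
rewrite !exprD.
have a0 : q ^+ (m - j) != 0 by rewrite expf_neq0.
have b0 : q ^+ j != 0 by rewrite expf_neq0.
by field; rewrite two0 a0 b0.
Qed.

(** By [lattice_sub] the difference of nodes supplies exactly the last factors
    1 - q^(n+1-j) and 1 - q^(n+1+j) of the two q-Pochhammer symbols. *)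
Lemma aw_coef_rec n j : (j <= n)%N ->
  aw_coef n.+1 j * (lattice q n.+1 - lattice q j) =
  q ^- n.+1 / 2 * aw_coef n j.
Proof.
move=> jn; rewrite lattice_sub ?leqW // /aw_coef subSn // addSn !qpochS.
have := (qpoch_neq0 (n - j), qpoch_neq0 (n + j)).
have := (sub1X_neq0 (n - j), sub1X_neq0 (n + j)).
have : q ^+ n.+1 != 0 by rewrite expf_neq0.
move: (1 - q ^+ _.+1) (1 - q ^+ _.+1) (qpoch _ _ _) (qpoch _ _ _) => a b c d.
move: (q ^+ n.+1) (_ * (1 + _)) => e f e0 [a0 b0] [c0 d0].
by field; rewrite a0 b0 c0 d0 e0 two0.
Qed.

(** The recurrence holds separately for each j, through [aw_coef_rec]; the term
    j = n+1 drops out because its node is the coefficient lattice q (n+1). *)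
Lemma aw_closed_rec k n :
  aw_closed k.+1 n.+1 =
  lattice q n.+1 * aw_closed k n.+1 - q ^- n / 2 * aw_closed k n.
Proof.
have qn0 : q ^+ n != 0 by rewrite expf_neq0.
have qS0 : q ^+ n.+1 != 0 by rewrite expf_neq0.
have hs : \sum_(1 <= j < n.+2) aw_coef n.+1 j * lattice q j ^+ k.+1 =
  lattice q n.+1 * \sum_(1 <= j < n.+2) aw_coef n.+1 j * lattice q j ^+ k
  - q ^- n.+1 / 2 * \sum_(1 <= j < n.+1) aw_coef n j * lattice q j ^+ k.
  rewrite !(big_nat_recr n.+1) //= !mulrDr !mulr_sumr.
  rewrite (eq_big_nat _ _ (F2 := fun j =>
     lattice q n.+1 * (aw_coef n.+1 j * lattice q j ^+ k)
     - q ^- n.+1 / 2 * (aw_coef n j * lattice q j ^+ k))); last first.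
    move=> j /andP[_ jn]; rewrite (mulrA (q ^- _ / 2)) -aw_coef_rec // exprS.
    by ring.
  rewrite sumrB (exprS (lattice q n.+1)).
  ring.
(* The constant term belongs to j = 0, whose node is 1. *)
have h0 : 1 / qpoch q q n.+1 ^+ 2 =
  lattice q n.+1 * (1 / qpoch q q n.+1 ^+ 2)
  - q ^- n.+1 / 2 * (1 / qpoch q q n ^+ 2).
  have := lattice_sub _ _ (leq0n n.+1).
  rewrite subn0 addn0 {2}/lattice expr0 invr1 -[1 + 1]/(2 : F) divff //.
  move/(canRL (subrK _)) => ->; rewrite qpochS.
  have := qpoch_neq0 n; have := sub1X_neq0 n; move: (qpoch _ _ _) => a b0 a0.
  move: (q ^+ n.+1) qS0 b0 => e e0 b0.
  by field; rewrite a0 b0 e0 two0.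
rewrite /aw_closed hs [in LHS]h0.
move: (\sum_(_ <= _ < _) _) (\sum_(_ <= _ < _) _) (1 / _) (1 / _) (lattice _ _).
by move=> *; rewrite exprS; field; rewrite q0 qn0 two0.
Qed.

(** An alternating sum of q-binomial coefficients telescopes: this is
    the q-analogue of the evaluation of partial alternating sums of a row of
    Pascal's triangle.  At m = n+1 the factor 1 - q^(n+1-m) vanishes, which
    gives the finite q-binomial theorem needed for k = 0. *)
Lemma aw_coef_psum n m : (m <= n.+1)%N ->
  1 / qpoch q q n.+1 ^+ 2 + \sum_(1 <= j < m.+1) aw_coef n.+1 j =
  (-1) ^+ m * q ^+ 'C(m.+1, 2) * (1 - q ^+ (n.+1 - m)) /
  ((1 - q ^+ n.+1) * (qpoch q q (n.+1 - m) * qpoch q q (n.+1 + m))).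
Proof.
elim: m => [|m IH] mn.
  rewrite big_geq // addr0 expr0 expr0 subn0 addn0 !mul1r expr2.
  have := sub1X_neq0 n; have := qpoch_neq0 n.+1.
  move: (qpoch _ _ _) (q ^+ n.+1) => a e a0 e0.
  by field; rewrite a0 e0.
rewrite big_nat_recr //= addrA IH 1?ltnW // /aw_coef.
rewrite subSn // addnS (qpochS (n - m)) (qpochS (n.+1 + m)) subSS.
have -> : q ^+ 'C(m.+2, 2) = q ^+ 'C(m.+1, 2) * q ^+ m.+1.
  by rewrite binS bin1 exprD.
(* Everything becomes rational in q, t = q^m and u = q^(n-m). *)
have e1 : q ^+ n.+1 = q ^+ (n - m) * q ^+ m.+1 by rewrite -exprD addnS subnK.
have := sub1X_neq0 (n.+1 + m); have := sub1X_neq0 (n - m).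
have := sub1X_neq0 n; rewrite -addnS exprD e1 !(exprS _ (n - m)) !(exprS _ m).
have := qpoch_neq0 (n - m); have := qpoch_neq0 (n.+1 + m).
move: (qpoch _ _ _) (qpoch _ _ _) (q ^+ (n - m)) (q ^+ m) (q ^+ 'C(_, _)).
move: ((-1) ^+ m) => s A B u t D A0 B0 h1 h2 h3.
by field; rewrite A0 B0 h1 h2 h3.
Qed.

Lemma aw_closed0 k : aw_closed k 0 = 1.
Proof. by rewrite /aw_closed big_geq // /qpoch big_ord0 expr1n divr1 addr0 mulr1. Qed.

Lemma aw_closed0n n : aw_closed 0 n.+1 = 0.
Proof.
rewrite /aw_closed.
under eq_bigr do rewrite expr0 mulr1.
by rewrite aw_coef_psum // subnn expr0 subrr mulr0 mul0r mulr0.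
Qed.
End ClosedForm.

(** * Sign and growth *)

Section Real.
Context {R : realType} (q : R).
Hypotheses (hq0 : 0 < q) (hq1 : q < 1).

Lemma lt1_exp_neq1 k : q ^+ k.+1 != 1.
Proof. by rewrite lt_eqF // expr_lt1 // ltW. Qed.

Lemma awTE k n : awT q k n = (aw_closed q k n)%:C.
Proof.
have q0 : q != 0 by rewrite gt_eqF.
have two0 : (2 : R) != 0 by rewrite pnatr_eq0.
have q1 := lt1_exp_neq1.
elim: k n => [|k IH] [|n]; rewrite ?awT0 ?aw_closed0 ?rmorph1 //.
  by rewrite awT0n ?aw_closed0n ?rmorph0.
by rewrite awT_rec // !IH aw_closed_rec // -!rmorphM -rmorphB.
Qed.

Lemma aw_closed_eq0 k n : (k < n)%N -> aw_closed q k n = 0.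
Proof.
have q0 : q != 0 by rewrite gt_eqF.
have two0 : (2 : R) != 0 by rewrite pnatr_eq0.
have q1 := lt1_exp_neq1.
elim: k n => [|k IH] [|n] // kn; first exact: aw_closed0n.
by rewrite aw_closed_rec // !IH ?mulr0 ?subrr // ltnW.
Qed.

Lemma lattice_gt0 n : 0 < lattice q n.
Proof. by rewrite divr_gt0 // addr_gt0 ?invr_gt0 ?exprn_gt0. Qed.

(** The sign (-1)^n makes both coefficients of the recurrence positive. *)
Lemma sign_aw_closed_rec k n :
  (-1) ^+ n.+1 * aw_closed q k.+1 n.+1 =
  lattice q n.+1 * ((-1) ^+ n.+1 * aw_closed q k n.+1) +
  q ^- n / 2 * ((-1) ^+ n * aw_closed q k n).
Proof.
rewrite aw_closed_rec ?gt_eqF ?pnatr_eq0 //; last exact: lt1_exp_neq1.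
by rewrite exprS; ring.
Qed.

Lemma sign_aw_closed_ge0 k n : 0 <= (-1) ^+ n * aw_closed q k n.
Proof.
elim: k n => [|k IH] [|n].
- by rewrite aw_closed0 mulr1 expr0 ler01.
- by rewrite aw_closed_eq0 // mulr0.
- by rewrite aw_closed0 mulr1 expr0 ler01.
rewrite sign_aw_closed_rec addr_ge0 // mulr_ge0 // ?(ltW (lattice_gt0 _)) //.
by rewrite divr_ge0 // invr_ge0 exprn_ge0 // ltW.
Qed.

(** Each factor satisfies 1/(1-u) = 1 + u/(1-u) <= 1 + u/(1-x) <=
    exp(u/(1-x)) for u = x^(i+1) <= x, and the exponents form a geometric
    series. *)
Lemma inv_qpoch_le (x : R) n : 0 < x -> x < 1 ->
  (qpoch x x n)^-1 <= expR (x / (1 - x) ^+ 2).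
Proof.
move=> x0 x1; have y0 : 0 < 1 - x by rewrite subr_gt0.
have xn0 m : 0 < x ^+ m by rewrite exprn_gt0.
suff h : (qpoch x x n)^-1 <= expR (x * (1 - x ^+ n) / (1 - x) ^+ 2).
  apply: le_trans h _; rewrite ler_expR ler_pM2r ?invr_gt0 ?exprn_gt0 //.
  by rewrite ler_piMr ?ltW // ltrBlDr ltrDl.
elim: n => [|n IH].
  by rewrite /qpoch big_ord0 expr0 subrr mulr0 mul0r expR0 invr1.
have -> : x * (1 - x ^+ n.+1) / (1 - x) ^+ 2 =
    x * (1 - x ^+ n) / (1 - x) ^+ 2 + x ^+ n.+1 / (1 - x).
  by rewrite exprS; field; rewrite gt_eqF.
rewrite qpochS invfM expRD ler_pM ?invr_ge0 //.
- by apply: prodr_ge0 => i _; rewrite -exprS subr_ge0 exprn_ile1 // ltW.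
- by rewrite subr_ge0 exprn_ile1 // ltW.
have u1 : x ^+ n.+1 <= x by rewrite exprS ler_piMr ?exprn_ile1 ?ltW.
have z0 : 0 < 1 - x ^+ n.+1 by rewrite subr_gt0 (le_lt_trans u1).
apply: le_trans (expR_ge1Dx _).
have -> : (1 - x ^+ n.+1)^-1 = 1 + x ^+ n.+1 / (1 - x ^+ n.+1).
  by field; rewrite gt_eqF.
by rewrite lerD2l ler_pM2l // lef_pV2 ?posrE // lerB.
Qed.

(** With M_n = 1/(q^2;q^2)_n one has M_n = (1 - q^(2n+2)) M_(n+1), so
    (1 + q^(2n+2))/2 M_(n+1) + 1/2 M_n = M_(n+1): the bound is preserved
    by the recurrence, with slack coming from q^(k-n) <= 1. *)
Lemma sign_aw_closed_le k n :
  (-1) ^+ n * aw_closed q k n <=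
  (qpoch (q ^+ 2) (q ^+ 2) n)^-1 * q ^+ 'C(n.+1, 2) / q ^+ (n * k).
Proof.
have r0 : 0 < q ^+ 2 by rewrite exprn_gt0.
have r1 : q ^+ 2 < 1 by rewrite expr_lt1 // ltW.
have qp m : 0 < qpoch (q ^+ 2) (q ^+ 2) m.
  by apply: prodr_gt0 => i _; rewrite -exprS subr_gt0 exprn_ilt1 // ltW.
have rhs_ge0 m l : 0 <= (qpoch (q ^+ 2) (q ^+ 2) m)^-1 * q ^+ 'C(m.+1, 2) / q ^+ (m * l).
  by rewrite !mulr_ge0 ?invr_ge0 ?exprn_ge0 // ltW.
elim: k n => [|k IH] n.
  case: n => [|n]; last by rewrite aw_closed_eq0 // mulr0.
  by rewrite aw_closed0 /qpoch big_ord0 !expr0 divr1 invr1 !mul1r.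
case: n => [|n].
  by rewrite aw_closed0 /qpoch big_ord0 !expr0 divr1 invr1 !mul1r.
have [kn|nk] := ltnP k n; first by rewrite aw_closed_eq0 // mulr0.
rewrite sign_aw_closed_rec.
apply: (@le_trans _ _
  (lattice q n.+1 *
     ((qpoch (q ^+ 2) (q ^+ 2) n.+1)^-1 * q ^+ 'C(n.+2, 2) / q ^+ (n.+1 * k)) +
   q ^- n / 2 * ((qpoch (q ^+ 2) (q ^+ 2) n)^-1 * q ^+ 'C(n.+1, 2) / q ^+ (n * k)))).
  apply: lerD; rewrite ler_pM2l ?lattice_gt0 //.
  by rewrite divr_gt0 // invr_gt0 exprn_gt0.
have w0 : 0 < 1 - (q ^+ 2) ^+ n.+1 by rewrite subr_gt0 exprn_ilt1 // ltW.
rewrite qpochS.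
have e1 : q ^+ 'C(n.+2, 2) = q ^+ 'C(n.+1, 2) * q ^+ n.+1.
  by rewrite binS bin1 exprD.
have e2 : q ^+ k = q ^+ (k - n) * q ^+ n by rewrite -exprD subnK.
have i1 : q ^+ (k - n) <= 1 by rewrite exprn_ile1 // ltW.
have e3 : q ^+ (n.+1 * k) = q ^+ (k - n) * q ^+ n * q ^+ (n * k).
  by rewrite mulSn exprD e2.
have e4 : q ^+ (n.+1 * k.+1) = q ^+ (n.+1 * k) * q ^+ n.+1.
  by rewrite mulnS addnC exprD.
rewrite e4 e3 e1 /lattice.
have i0 : 0 < q ^+ (k - n) by rewrite exprn_gt0.
have v0 : 0 < q ^+ n by rewrite exprn_gt0.
have W0 : 0 < q ^+ (n * k) by rewrite exprn_gt0.
have D0 : 0 < q ^+ 'C(n.+1, 2) by rewrite exprn_gt0.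
have {qp} M0 := qp n.
have e5 : (q ^+ 2) ^+ n.+1 = q ^+ n.+1 * q ^+ n.+1 by rewrite exprAC expr2.
rewrite e5 in w0 *.
rewrite -subr_ge0.
move: (qpoch _ _ _) (q ^+ (k - n)) (q ^+ (n * k)) (q ^+ 'C(_, _)) M0 i0 i1 W0 D0.
rewrite !exprS in w0 *; move: (q ^+ n) v0 w0 => v v0 w0.
move=> M i W D M0 i0 i1 W0 D0.
rewrite [X in 0 <= X](_ : _ = D * (1 - i) / (2 * M * i * v * W)).
  by rewrite divr_ge0 ?mulr_ge0 ?subr_ge0 // ltW.
by field; rewrite !gt_eqF.
Qed.
End Real.

Theorem proposition2p10 (R : realType) (q : R) (hq0 : 0 < q) (hq1 : q < 1) :
  (forall k : nat, awT q k 0 = 1) /\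
  (forall k n : nat, (k < n)%N -> awT q k n = 0) /\
  (forall k n : nat, (0 < k)%N -> (0 < n)%N ->
     awT q k n =
     (q ^+ n *
       (1 / qpoch q q n ^+ 2 +
        \sum_(1 <= j < n.+1)
          (-1) ^+ j * q `^ (j%:R * (j%:R - 1) / 2) * (1 + q ^+ j) /
          (qpoch q q (n - j) * qpoch q q (n + j)) *
          ((q ^+ j + q ^- j) / 2) ^+ k))%:C) /\
  (* (i) *)
  (forall k n : nat, (0 < k)%N -> (0 < n)%N ->
     awT q k n =
     ((q ^+ n + q ^- n) / 2)%:C * awT q (k - 1) n
     - (q `^ (1 - n%:R) / 2)%:C * awT q (k - 1) (n - 1)) /\
  (forall k n : nat, 0 <= (-1) ^+ n * awT q k n) /\
  (* (ii) *)
  (exists K : R, 0 < K /\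
     forall k n : nat, (0 < k)%N -> (0 < n)%N ->
       (-1) ^+ n * awT q k n <=
       (K * q `^ (n%:R * (n%:R + 1) / 2) / q ^+ (n * k))%:C).
Proof.
have binR (j : nat) : q `^ (j%:R * (j%:R - 1) / 2) = q ^+ 'C(j, 2).
  rewrite -powR_mulrn ?ltW //; congr (_ `^ _).
  apply: (@mulIf _ 2); first by rewrite pnatr_eq0.
  rewrite divfK ?pnatr_eq0 // -natrM -[X in (_ * X)%N]/(2`!) bin_ffact ffactnS ffactn1.
  by case: j => [|j]; rewrite ?mul0r // natrM /= -[in LHS]natr1 addrK natr1.
have signC k n : (-1) ^+ n * awT q k n = ((-1) ^+ n * aw_closed q k n)%:C.
  by rewrite awTE // [RHS]rmorphM rmorph_sign.
do !split.
- exact: awT0.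
- by move=> k n kn; rewrite awTE // aw_closed_eq0 // rmorph0.
- move=> k n _ _; rewrite awTE //; congr (_ * (_ + _))%:C.
  by apply: eq_bigr => j _; rewrite binR.
- move=> [|k] [|n] // _ _; rewrite !subn1 /= awT_rec //.
  by rewrite -(natr1 n) opprD addrCA subrr addr0 powRN powR_mulrn // ltW.
- by move=> k n; rewrite signC lecR; exact: sign_aw_closed_ge0.
have r0 : 0 < q ^+ 2 by rewrite exprn_gt0.
have r1 : q ^+ 2 < 1 by rewrite expr_lt1 // ltW.
exists (expR (q ^+ 2 / (1 - q ^+ 2) ^+ 2)); split; first exact: expR_gt0.
move=> k n _ _; rewrite signC lecR.
apply: le_trans (sign_aw_closed_le _ _ _ _ _) _ => //.
have -> : n%:R * (n%:R + 1) / 2 = n.+1%:R * (n.+1%:R - 1) / 2 :> R.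
  by rewrite -(natr1 n) addrK (mulrC n%:R).
rewrite binR !ler_pM2r ?invr_gt0 ?exprn_gt0 //.
exact: inv_qpoch_le.
Qed.
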